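(* Let $(\mathsf X,\mathsf A,\{\mathsf A(x)\}_{x\in\mathsf X},Q,c)$ be a Markov control process with set of feasible pairs $\mathsf K$, let $w_0:\mathsf X\to[0,\infty)$ be Borel measurable, let $\mathcal R$ be a risk map on $\mathscr B_{1+w_0}$, and put $\mathcal T_{x,a}(v):=c(x,a)+\mathcal R_{x,a}(v)$. Suppose there are constants $\gamma_0\in(0,1)$ and $K_0>0$ such that: (A1) $\max\{\mathcal T_{x,a}(w_0),\,-\mathcal T_{x,a}(-w_0)\}\le \gamma_0 w_0(x)+K_0$ for all $(x,a)\in\mathsf K$; (A2) there is a constant $K>K_0$ such that $$\mathcal R_{x,a}(w_0+K)-\mathcal R_{x,a}(v)+\mathcal R_{y,b}(v)-\mathcal R_{y,b}(-w_0-K)\ge 2K_0$$ for all $v\in\mathscr B_{1+w_0}$ with $|v|\le w_0+K$, all $x,y\in\mathsf B_0:=\{x\in\mathsf X: w_0(x)\le \frac{2K_0}{1-\gamma_0}\}$, all $a\in\mathsf A(x)$ and all $b\in\mathsf A(y)$. Then for each $\pi\in\Delta$ and each $v\in\mathscr B_{1+w_0}$, $$\|\mathcal T^\pi(v)\|_{s,1+K^{-1}w_0}\le K\quad\text{whenever}\quad \|v\|_{s,1+K^{-1}w_0}\le K.$$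
   Context: Markov control process: $\mathsf X$ (states) and $\mathsf A$ (actions) are Borel spaces (Borel subsets of complete separable metric spaces); for each $x\in\mathsf X$, $\mathsf A(x)\subset\mathsf A$ is a nonempty Borel set of feasible actions; $\mathsf K:=\{(x,a):x\in\mathsf X,a\in\mathsf A(x)\}$ is a Borel subset of $\mathsf X\times\mathsf A$; $Q$ is a stochastic kernel on $\mathsf X$ given $\mathsf K$, with $Q_{x,a}(\cdot):=Q(\cdot|x,a)$; $c:\mathsf K\to\mathbb R$ is Borel measurable. $\Delta$ is the set of stochastic kernels $\pi$ on $\mathsf A$ given $\mathsf X$ with $\pi(\mathsf A(x)|x)=1$ for all $x$. Weighted spaces: for measurable $w:\mathsf X\to[1,\infty)$, $\|u\|_w:=\sup_x |u(x)|/w(x)$, $\mathscr B_w$ is the space of real-valued Borel functions on $\mathsf X$ with $\|u\|_w<\infty$, and $\|v\|_{s,w}:=\sup_{x\ne y}\frac{|v(x)-v(y)|}{w(x)+w(y)}$. Note $\mathscr B_{1+\beta w_0}=\mathscr B_{1+w_0}$ for every $\beta>0$. Real numbers are identified with constant functions; $\le$ between functions is pointwise. Risk map: let $\mathscr P$ be the set of Borel probability measures on $\mathsf X$. A risk measure is $\nu:\mathscr B_w\times\mathscr P\to\mathbb R\cup\{\pm\infty\}$ such that for each $\mu\in\mathscr P$: $\nu(v,\mu)\le\nu(u,\mu)$ whenever $v\le u$; $\nu(v+r,\mu)=\nu(v,\mu)+r$ for $r\in\mathbb R$; $\nu(0,\mu)=0$. A risk map on $\mathscr B_w$ is $\mathcal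 R:\mathscr B_w\times\mathsf K\to\mathbb R$, written $\mathcal R_{x,a}(v)=\mathcal R(v|x,a)$, such that for each $(x,a)$ one has $\mathcal R_{x,a}(\cdot)=\nu(\cdot,Q_{x,a})$ for some risk measure $\nu$, and $(x,a)\mapsto\mathcal R(v|x,a)$ is Borel measurable for each $v$. For $\pi\in\Delta$, $\mathcal T^\pi(v)$ is the function $\mathcal T^\pi_x(v):=\int_{\mathsf A(x)}\mathcal T_{x,a}(v)\,\pi(da|x)$. *)

(* Defs.v *)
From HB Require Import structures.
From mathcomp Require Import all_boot all_order all_algebra.
From mathcomp Require Import all_classical all_reals all_analysis.
From mathcomp Require Import measurable_realfun.

Set Implicit Arguments.
Unset Strict Implicit.
Unset Printing Implicit Defensive.
Import Order.TTheory GRing.Theory Num.Theory.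
Import numFieldNormedType.Exports.

Local Open Scope classical_set_scope.
Local Open Scope ring_scope.

(* [T], with its sigma-algebra, is a Borel subset of a complete separable metric
   space [E]: the injection [i] identifies [T] with a Borel subset of [E], and
   the measurable sets of [T] are the traces of the Borel sets of [E]. *)
Definition borel_space (R : realType) (d : measure_display)
    (T : measurableType d) : Prop :=
  exists (E : metricType R) (i : T -> E),
    [/\ forall F : set_system E, ProperFilter F -> cauchy F ->
          exists x : E, F --> x,
        exists2 D : set E, countable D & dense D,
        injective i,
        <<s @open E >> (range i) &
        forall B : set T,
          measurable B <-> exists2 C : set E, <<s @open E >> C & B = i @^-1` C].

Definition feasible_pairs (X A : Type) (Af : X -> set A) : set (X * A) :=
  [set xa | Af xa.1 xa.2].

(* The kernel and the cost are total functions on [X * A]; only their values on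
   the feasible pairs are constrained or used.  On Borel spaces the product
   sigma-algebra of [X * A] is its Borel sigma-algebra. *)
Record markov_control_process (R : realType) (dX dA : measure_display)
    (X : measurableType dX) (A : measurableType dA) := MarkovControlProcess {
  mcp_state_borel : borel_space R X ;
  mcp_action_borel : borel_space R A ;
  feasible : X -> set A ;
  feasible_nonempty : forall x, feasible x !=set0 ;
  feasible_measurable : forall x, measurable (feasible x) ;
  feasible_pairs_measurable : measurable (feasible_pairs feasible) ;
  transition : X * A -> probability X R ;
  transition_measurable : forall B : set X, measurable B ->
    measurable_fun (feasible_pairs feasible) (transition ^~ B) ;
  cost : X * A -> R ;
  cost_measurable : measurable_fun (feasible_pairs feasible) cost }.

Section weighted_spaces.
Context (R : realType) (d : measure_display) (X : measurableType d).
Implicit Types w u v : X -> R.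

Definition wnorm w u : \bar R :=
  ereal_sup [set (`|u x| / w x)%:E | x in [set: X]].

Definition weighted_space w : set (X -> R) :=
  [set u | measurable_fun [set: X] u /\ (wnorm w u < +oo)%E].

(* When [X] is a singleton this supremum is [-oo] rather than [0]; the seminorm
   only occurs in upper bounds by positive numbers. *)
Definition wseminorm w v : \bar R :=
  ereal_sup [set (`|v xy.1 - v xy.2| / (w xy.1 + w xy.2))%:E
            | xy in [set xy : X * X | xy.1 <> xy.2]].

Definition risk_measure w (nu : (X -> R) -> probability X R -> \bar R) : Prop :=
  forall mu : probability X R,
    [/\ forall v u, weighted_space w v -> weighted_space w u ->
          (forall x, v x <= u x) -> (nu v mu <= nu u mu)%E,
        forall v (r : R), weighted_space w v ->
          nu (fun x => v x + r) mu = (nu v mu + r%:E)%E &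
        nu (fun=> 0) mu = 0%E].

End weighted_spaces.

Section risk_maps.
Context (R : realType) (dX dA : measure_display).
Context (X : measurableType dX) (A : measurableType dA).
Context (M : markov_control_process R X A).

Definition risk_map (w : X -> R) (rho : (X -> R) -> X * A -> R) : Prop :=
  (forall xa, feasible_pairs (feasible M) xa ->
     exists2 nu : (X -> R) -> probability X R -> \bar R,
       risk_measure w nu &
       forall v, weighted_space w v -> (rho v xa)%:E = nu v (transition M xa)) /\
  (forall v, weighted_space w v ->
     measurable_fun (feasible_pairs (feasible M)) (rho v)).

Definition randomized_policy : set (R.-pker X ~> A) :=
  [set p : R.-pker X ~> A | forall x, p x (feasible M x) = 1%E].

Definition dp_operator (rho : (X -> R) -> X * A -> R) (v : X -> R)
    (xa : X * A) : R :=
  cost M xa + rho v xa.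

Definition policy_operator (rho : (X -> R) -> X * A -> R)
    (p : R.-pker X ~> A) (v : X -> R) (x : X) : R :=
  Rintegral (p x) (feasible M x) (fun a => dp_operator rho v (x, a)).

End risk_maps.

(* Main.v *)
Require Import Defs.
From HB Require Import structures.
From mathcomp Require Import all_boot all_order all_algebra.
From mathcomp Require Import all_classical all_reals all_analysis.
From mathcomp Require Import measurable_realfun ring lra.

(* The hypothesis on [v] says [|v x - v y| <= 2 K + w0 x + w0 y], so some
   constant [c] satisfies [|v - c| <= w0 + K].  Constants pass through the risk
   map, hence [T_{x,a} v - T_{y,b} v] may be estimated with [v - c] in place of
   [v].  By monotonicity and (A1) it is at most
   [gamma0 (w0 x + w0 y) + 2 K0 + 2 K], which is at most [w0 x + w0 y + 2 K]
   when [w0 x + w0 y >= 2 K0 / (1 - gamma0)]; otherwise [x] and [y] lie in the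
   sublevel set of (A2), which removes the term [2 K0].  This pointwise estimate
   survives averaging over the actions. *)

Set Implicit Arguments.
Unset Strict Implicit.
Unset Printing Implicit Defensive.
Import Order.TTheory GRing.Theory Num.Theory.
Import numFieldNormedType.Exports.

Local Open Scope classical_set_scope.
Local Open Scope ring_scope.

Section integral_bounds.
Context (R : realType).

Lemma Rintegral_le_cst (d : measure_display) (T : measurableType d)
    (mu : {measure set T -> \bar R}) (D : set T) (f : T -> R) (c : R) :
  measurable D -> mu D = 1%E -> mu.-integrable D (EFin \o f) ->
  (forall a, D a -> f a <= c) -> \int[mu]_(a in D) f a <= c.
Proof.
move=> mD muD fi fc.
have ci : mu.-integrable D (EFin \o cst c).
  apply: measurable_bounded_integrable => //; first by rewrite muD ltry.
  by exists `|c|; split=> // M cM x _ /=; exact: ltW.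
by apply: le_trans (le_Rintegral mD fi ci fc) _; rewrite Rintegral_cst// muD mulr1.
Qed.

Lemma Rintegral_ge_cst (d : measure_display) (T : measurableType d)
    (mu : {measure set T -> \bar R}) (D : set T) (f : T -> R) (c : R) :
  measurable D -> mu D = 1%E -> mu.-integrable D (EFin \o f) ->
  (forall a, D a -> c <= f a) -> c <= \int[mu]_(a in D) f a.
Proof.
move=> mD muD fi fc.
have ci : mu.-integrable D (EFin \o cst c).
  apply: measurable_bounded_integrable => //; first by rewrite muD ltry.
  by exists `|c|; split=> // M cM x _ /=; exact: ltW.
by apply: le_trans (le_Rintegral mD ci fi fc); rewrite Rintegral_cst// muD mulr1.
Qed.

(** On a set of mass one, staying within [B] of a reference value bounds [f] by [|r| + B].
    Integrability over the actions is obtained this way, from an oscillation bound. *)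
Lemma integrable_of_dist_le (d : measure_display) (T : measurableType d)
    (mu : {measure set T -> \bar R}) (D : set T) (f : T -> R) (r B : R) :
  measurable D -> mu D = 1%E -> measurable_fun D f ->
  (forall a, D a -> `|f a - r| <= B) -> mu.-integrable D (EFin \o f).
Proof.
move=> mD muD mf fr; apply: measurable_bounded_integrable => //.
  by rewrite muD ltry.
exists (`|r| + B); split=> [|M ltM]; first exact: num_real.
move=> a Da /=; apply: le_trans (ltW ltM).
by rewrite -[f a](subrK r) addrC (le_trans (ler_normD _ _))// lerD2l fr.
Qed.

(** The bound is uniform in both variables, so they are integrated one at a time, without a product
    measure. A point of each set supplies the reference value that makes the other function
    integrable. *)
Lemma dist_Rintegral_le (d1 d2 : measure_display)
    (T1 : measurableType d1) (T2 : measurableType d2)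
    (mu : {measure set T1 -> \bar R}) (nu : {measure set T2 -> \bar R})
    (D : set T1) (E : set T2) (f : T1 -> R) (g : T2 -> R) (B : R) :
  measurable D -> measurable E -> D !=set0 -> E !=set0 ->
  mu D = 1%E -> nu E = 1%E -> measurable_fun D f -> measurable_fun E g ->
  (forall a b, D a -> E b -> `|f a - g b| <= B) ->
  `|\int[mu]_(a in D) f a - \int[nu]_(b in E) g b| <= B.
Proof.
move=> mD mE [a0 Da0] [b0 Eb0] muD nuE mf mg fg.
have fi : mu.-integrable D (EFin \o f).
  by apply: (@integrable_of_dist_le _ _ _ _ _ (g b0) B) => // a Da; exact: fg.
have gi : nu.-integrable E (EFin \o g).
  by apply: (@integrable_of_dist_le _ _ _ _ _ (f a0) B) => // b Eb;
     rewrite distrC; exact: fg.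
rewrite ler_distl; apply/andP; split.
- apply: Rintegral_ge_cst => // a Da; rewrite lerBlDr.
  apply: Rintegral_le_cst => // b Eb.
  by have := fg _ _ Da Eb; rewrite ler_distl => /andP[]; lra.
- apply: Rintegral_le_cst => // a Da; rewrite -lerBlDr.
  apply: Rintegral_ge_cst => // b Eb.
  by have := fg _ _ Da Eb; rewrite ler_distl => /andP[]; lra.
Qed.

End integral_bounds.

Section weighted_spaces.
Context (R : realType) (d : measure_display) (X : measurableType d).
Context (w : X -> R).
Hypothesis w_gt0 : forall x, 0 < w x.
Implicit Types v : X -> R.

Lemma weighted_spaceP v :
  weighted_space w v <->
  measurable_fun [set: X] v /\ exists C : R, forall x, `|v x| <= C * w x.
Proof.
split=> -[mv].
- move=> vfin; split=> //.
  have le_wnorm x : ((`|v x| / w x)%:E <= wnorm w v)%E.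
    by apply: ereal_sup_ubound; exists x.
  move: vfin le_wnorm; case: (wnorm w v) => [r| |]//= _ rP.
  + by exists r => x; rewrite -ler_pdivrMr// -lee_fin.
  (* The supremum is [-oo] here; any point [x] would contradict this, so every constant works. *)
  + by exists 0 => x; have := rP x.
- move=> [C vC]; split=> //; apply: (@le_lt_trans _ _ C%:E); last exact: ltry.
  by apply: ge_ereal_sup => _ [x _ <-]; rewrite lee_fin ler_pdivrMr.
Qed.

(** The sign of [K] settles the diagonal [x = y], which the supremum leaves out. *)
Lemma wseminorm_leP v (K : R) : 0 <= K ->
  (wseminorm w v <= K%:E)%E <->
  forall x y, `|v x - v y| <= K * (w x + w y).
Proof.
move=> K0; split=> [vK x y|vK].
- have [->|/eqP xy] := eqVneq x y.
    by rewrite subrr normr0 mulr_ge0// addr_ge0// ltW.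
  rewrite -ler_pdivrMr ?addr_gt0// -lee_fin; apply: le_trans vK.
  by apply: ereal_sup_ubound; exists (x, y).
- by apply: ge_ereal_sup => _ [[x y] _ <-]; rewrite lee_fin ler_pdivrMr ?addr_gt0.
Qed.

Lemma weighted_space_addr v (r : R) : (forall x, 1 <= w x) ->
  weighted_space w v -> weighted_space w (fun x => v x + r).
Proof.
move=> w_ge1 /weighted_spaceP[mv [C vC]]; apply/weighted_spaceP; split.
  exact: measurable_funD.
(* Since [1 <= w], the constant [r] is dominated by [|r| * w]. *)
exists (C + `|r|) => x; rewrite mulrDl (le_trans (ler_normD _ _))// lerD//.
by rewrite ler_peMr.
Qed.

Lemma weighted_space_opp v :
  weighted_space w v -> weighted_space w (fun x => - v x).
Proof.
move=> /weighted_spaceP[mv [C vC]]; apply/weighted_spaceP; split.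
  exact: measurableT_comp.
by exists C => x; rewrite normrN.
Qed.

End weighted_spaces.

(** The intervals [[v x - h x, v x + h x]] meet pairwise, hence have a common point, as in Helly's
    theorem on the line. The supremum of the left endpoints is such a point; the case of empty [T],
    with no endpoints, is set apart. *)
Lemma exists_center (R : realType) (T : Type) (v h : T -> R) :
  (forall x y, v x - v y <= h x + h y) ->
  exists c, forall x, `|v x - c| <= h x.
Proof.
move=> vh; have [[x0 _]|T0] := pselect (exists x : T, True); last first.
  by exists 0 => x; case: T0; exists x.
exists (sup (range (fun x => v x - h x))) => x.
rewrite distrC ler_distl; apply/andP; split.
- apply: ub_le_sup; last by exists x.
  by exists (v x + h x) => _ [y _ <-]; have := vh y x; lra.
- apply: ge_sup; first by exists (v x0 - h x0); exists x0.
  by move=> _ [y _ <-]; have := vh y x; lra.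
Qed.

Section risk_maps.
Context (R : realType) (dX dA : measure_display).
Context (X : measurableType dX) (A : measurableType dA).
Context (M : markov_control_process R X A).
Context (w : X -> R) (rho : (X -> R) -> X * A -> R).
Hypothesis rho_risk : risk_map M w rho.
Implicit Types u v : X -> R.

Lemma risk_map_le xa u v : feasible_pairs (feasible M) xa ->
  weighted_space w u -> weighted_space w v -> (forall x, u x <= v x) ->
  rho u xa <= rho v xa.
Proof.
move=> Kxa wu wv uv; have [nu /(_ (transition M xa))[nu_le _ _] nuE] := rho_risk.1 _ Kxa.
by rewrite -lee_fin !nuE//; exact: nu_le.
Qed.

Lemma risk_map_addr xa v (r : R) : (forall x, 1 <= w x) ->
  feasible_pairs (feasible M) xa -> weighted_space w v ->
  rho (fun x => v x + r) xa = rho v xa + r.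
Proof.
move=> w_ge1 Kxa wv.
have w_gt0 x : 0 < w x by exact: lt_le_trans (w_ge1 x).
have [nu /(_ (transition M xa))[_ nu_add _] nuE] := rho_risk.1 _ Kxa.
apply: EFin_inj; rewrite EFinD nuE; last exact: weighted_space_addr.
by rewrite nu_add// nuE.
Qed.

(** A section of a jointly measurable function: [pair x] sends [feasible M x] into the feasible
    pairs. *)
Lemma measurable_dp_operator v x : weighted_space w v ->
  measurable_fun (feasible M x) (fun a => dp_operator M rho v (x, a)).
Proof.
move=> wv; apply: (@measurable_comp _ _ _ _ _ _ (feasible_pairs (feasible M))
  (dp_operator M rho v) (feasible M x) (pair x)).
- exact: feasible_pairs_measurable.
- by move=> _ [a fa <-].
- by apply: measurable_funD; [exact: cost_measurable|exact: rho_risk.2].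
- by apply: measurable_funS (pair1_measurable x).
Qed.

End risk_maps.

Theorem theorem3p7 (R : realType) (dX dA : measure_display)
    (X : measurableType dX) (A : measurableType dA)
    (M : markov_control_process R X A)
    (w0 : X -> R) (w0_ge0 : forall x, 0 <= w0 x)
    (w0_meas : measurable_fun [set: X] w0)
    (rho : (X -> R) -> X * A -> R)
    (rho_risk : risk_map M (fun x => 1 + w0 x) rho)
    (gamma0 K0 : R) (gamma0_gt0 : 0 < gamma0) (gamma0_lt1 : gamma0 < 1)
    (K0_gt0 : 0 < K0)
    (A1 : forall (x : X) (a : A), feasible M x a ->
       Num.max (dp_operator M rho w0 (x, a))
               (- dp_operator M rho (fun z => - w0 z) (x, a))
         <= gamma0 * w0 x + K0)
    (K : R) (K_gtK0 : K0 < K)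
    (A2 : forall v : X -> R, weighted_space (fun x => 1 + w0 x) v ->
       (forall z, `|v z| <= w0 z + K) ->
       forall x y : X, w0 x <= 2 * K0 / (1 - gamma0) ->
         w0 y <= 2 * K0 / (1 - gamma0) ->
       forall a b : A, feasible M x a -> feasible M y b ->
       2 * K0 <= rho (fun z => w0 z + K) (x, a) - rho v (x, a)
                 + rho v (y, b) - rho (fun z => - w0 z - K) (y, b)) :
  forall p : R.-pker X ~> A, randomized_policy M p ->
  forall v : X -> R, weighted_space (fun x => 1 + w0 x) v ->
    (wseminorm (fun x => 1 + K^-1 * w0 x)%R v <= K%:E)%E ->
    (wseminorm (fun x => 1 + K^-1 * w0 x)%R (policy_operator M rho p v)
       <= K%:E)%E.
Proof.
move=> p pM v wv.
have K_gt0 : 0 < K by exact: lt_trans K_gtK0.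
have w_ge1 x : 1 <= 1 + w0 x by rewrite lerDl.
have w_gt0 x : 0 < 1 + w0 x by exact: lt_le_trans (w_ge1 x).
have wK_gt0 x : 0 < 1 + K^-1 * w0 x by rewrite ltr_pwDl// mulr_ge0// invr_ge0 ltW.
(* Clearing [K^-1] turns both seminorm bounds into oscillation bounds with [h = w0 + K], the
   envelope that appears in [A2]. *)
have wKE x y : K * (1 + K^-1 * w0 x + (1 + K^-1 * w0 y)) =
    (w0 x + K) + (w0 y + K) by field; rewrite gt_eqF.
have w0_in : weighted_space (fun x => 1 + w0 x) w0.
  apply/weighted_spaceP => //; split=> //; exists 1 => x.
  by rewrite mul1r ger0_norm// lerDr.
move=> /(wseminorm_leP wK_gt0 _ (ltW K_gt0)) v_le.
apply/(wseminorm_leP wK_gt0 _ (ltW K_gt0)) => x y; rewrite wKE.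
have [c vc] : exists c, forall x, `|v x - c| <= w0 x + K.
  apply: exists_center => z t; rewrite -wKE.
  exact: le_trans (ler_norm _) (v_le z t).
have u_in := weighted_space_addr w_gt0 (- c) w_ge1 wv.
have Nw0_in := weighted_space_opp w_gt0 w0_in.
(* A one-sided bound for arbitrary feasible pairs is enough: exchanging the pairs gives the other
   side. *)
have dp_le z t a b : feasible M z a -> feasible M t b ->
    dp_operator M rho v (z, a) - dp_operator M rho v (t, b) <=
    (w0 z + K) + (w0 t + K).
  move=> za tb; rewrite /dp_operator.
  (* The same [c] comes out at both pairs and cancels in the difference. *)
  have rvE s e : feasible M s e -> rho v (s, e) = rho (fun x => v x - c) (s, e) + c.
    by move=> se; rewrite (@risk_map_addr _ _ _ _ _ _ _ _ rho_risk (s, e) v (- c) w_ge1 se wv) subrK.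
  have upE := @risk_map_addr _ _ _ _ _ _ _ _ rho_risk (z, a) w0 K w_ge1 za w0_in.
  have loE :=
    @risk_map_addr _ _ _ _ _ _ _ _ rho_risk (t, b) _ (- K) w_ge1 tb Nw0_in.
  have up_in := weighted_space_addr w_gt0 K w_ge1 w0_in.
  have lo_in := weighted_space_addr w_gt0 (- K) w_ge1 Nw0_in.
  have up : rho (fun x => v x - c) (z, a) <= rho (fun x => w0 x + K) (z, a).
    by apply: (risk_map_le rho_risk) => // s; exact: le_trans (ler_norm _) (vc s).
  have lo : rho (fun x => - w0 x - K) (t, b) <= rho (fun x => v x - c) (t, b).
    apply: (risk_map_le rho_risk) => // s; have := vc s.
    by rewrite ler_norml => /andP[+ _]; lra.
  have := A1 _ _ za; rewrite /dp_operator ge_max => /andP[A1z _].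
  have := A1 _ _ tb; rewrite /dp_operator ge_max => /andP[_ A1t].
  rewrite (rvE _ _ za) (rvE _ _ tb).
  have g1 : 0 < 1 - gamma0 by rewrite subr_gt0.
  have w0z := w0_ge0 z; have w0t := w0_ge0 t.
  (* With [s = w0 z + w0 t], the far case reads [2 * K0 <= (1 - gamma0) * s], so
     [gamma0 * s + 2 * K0 <= s]. In the near case, nonnegativity of [w0] puts each summand below the
     threshold. *)
  have [le_far|lt_near] := leP (2 * K0 / (1 - gamma0)) (w0 z + w0 t).
    by move: le_far; rewrite ler_pdivrMr//; lra.
  have zB : w0 z <= 2 * K0 / (1 - gamma0) by lra.
  have tB : w0 t <= 2 * K0 / (1 - gamma0) by lra.
  (* For the centred function, [A2] improves the monotonicity bounds [up] and [lo] by [2 * K0] in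
     total, which cancels the two [K0] from [A1]. What remains is [gamma0 * s <= s]. *)
  have near := A2 _ u_in vc _ _ zB tB _ _ za tb.
  have := mulr_ge0 (ltW g1) (addr_ge0 w0z w0t).
  lra.
apply: dist_Rintegral_le; rewrite ?pM//.
- exact: feasible_measurable.
- exact: feasible_measurable.
- exact: feasible_nonempty.
- exact: feasible_nonempty.
- exact: measurable_dp_operator rho_risk _ _ wv.
- exact: measurable_dp_operator rho_risk _ _ wv.
- move=> a b xa yb; rewrite ler_norml; apply/andP; split.
    by have := dp_le _ _ _ _ yb xa; lra.
  exact: dp_le.
Qed.
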